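(* Let $f\in\mathcal{C}(\Omega)$ be nonzero, let $\lambda>0$ and let $\mu_1,\ldots,\mu_d>0$. Suppose the points $\mathbf{x}_1,\ldots,\mathbf{x}_N\in\Omega$ (distinct) and weights $w_1,\ldots,w_N>0$ satisfy the exactness property $\sum_{j=1}^N w_j g(\mathbf{x}_j)=\int_\Omega g\,\mathrm{d}\omega$ for all $g\in\mathbb{P}_{2L}$. Then the Lasso hyperinterpolation polynomial $$\mathcal{L}_L^{\lambda}f=\sum_{\ell=1}^{d}\mathcal{S}_{\lambda\mu_\ell}\left(\langle f,p_\ell\rangle_N\right)p_\ell\in\mathbb{P}_L$$ is the solution to the regularized least squares approximation problem $$\min_{p\in\mathbb{P}_L}\left\{\frac12\sum_{j=1}^N w_j\left(p(\mathbf{x}_j)-f(\mathbf{x}_j)\right)^2+\lambda\sum_{\ell=1}^{d}|\mu_\ell\beta_\ell|\right\}\quad\text{with}\quad p=\sum_{\ell=1}^{d}\beta_\ell p_\ell\in\mathbb{P}_L.$$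
   Context: $\Omega\subset\mathbb{R}^s$ is a compact smooth Riemannian manifold with smooth or empty boundary, equipped with a positive measure $\mathrm{d}\omega$ of finite total mass $V=\int_\Omega\mathrm{d}\omega<\infty$. $\mathcal{C}(\Omega)$ is the space of continuous real functions on $\Omega$. $\mathbb{P}_L$ is the linear space of polynomials on $\Omega$ of degree at most $L$, $d=\dim\mathbb{P}_L$, and $\{p_1,\ldots,p_d\}$ is an orthonormal basis of $\mathbb{P}_L$ with respect to $\langle v,z\rangle=\int_\Omega vz\,\mathrm{d}\omega$. The discrete inner product is $\langle v,z\rangle_N=\sum_{j=1}^N w_j v(\mathbf{x}_j)z(\mathbf{x}_j)$. The soft threshold operator is $\mathcal{S}_k(a)=\max(0,a-k)+\min(0,a+k)$. *)

(* Defs.v *)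
From HB Require Import structures.
From mathcomp Require Import all_boot all_order all_algebra.
From mathcomp Require Import all_classical all_reals all_analysis.
From mathcomp Require multinomials.mpoly.
Import Order.TTheory GRing.Theory Num.Theory.
Import numFieldNormedType.Exports.

Set Implicit Arguments.
Unset Strict Implicit.
Unset Printing Implicit Defensive.

Local Open Scope classical_set_scope.
Local Open Scope ring_scope.

(* On an open set, f is C^{k+1} iff all its directional derivatives exist and
   are C^k. *)
Fixpoint Ck_on (R : realType) (V W : normedModType R) (k : nat) (U : set V)
    (f : V -> W) : Prop :=
  (forall x, U x -> {for x, continuous f}) /\
  if k is k'.+1 then
    (forall x v, U x -> derivable f x v) /\ (forall v, Ck_on k' U ('D_v f))
  else True.

Definition smooth_on (R : realType) (V W : normedModType R) (U : set V)
    (f : V -> W) : Prop :=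
  forall k, Ck_on k U f.

(* {y | y_0 >= 0 and y_i = 0 for all i >= m}, a copy of the closed half-space
   of R^m inside R^s; it is the single point 0 when m = 0. *)
Definition half_space (R : realType) (s m : nat) : set 'rV[R]_s :=
  [set y | forall i : 'I_s,
     ((m <= i)%N -> y ord0 i = 0) /\ (i = 0%N :> nat -> 0 <= y ord0 i)].

(* m-dimensional embedded smooth submanifold of R^s with smooth, possibly
   empty, boundary: near each of its points, Omega is carried by a smooth
   diffeomorphism phi between open sets of R^s onto the half-space model.
   Interior points are those sent to y_0 > 0, so no other kind of chart is
   needed. The Riemannian metric is the one induced by R^s. *)
Definition submanifold_with_boundary (R : realType) (s m : nat)
    (Omega : set 'rV[R]_s) : Prop :=
  forall x, Omega x ->
  exists (U V : set 'rV[R]_s) (phi psi : 'rV[R]_s -> 'rV[R]_s),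
    [/\ open U /\ open V, U x,
        smooth_on U phi /\ smooth_on V psi,
        (forall y, U y -> V (phi y) /\ psi (phi y) = y) /\
        (forall z, V z -> U (psi z) /\ phi (psi z) = z) &
        forall y, U y -> (Omega y <-> half_space m (phi y))].

Definition compact_smooth_manifold (R : realType) (s : nat)
    (Omega : set 'rV[R]_s) : Prop :=
  compact Omega /\
  exists2 m, (m <= s)%N & submanifold_with_boundary m Omega.

Notation borel_space R s := (g_sigma_algebraType (@open 'rV[R]_s)).

(* Functions on Omega are represented by functions on R^s of which only the
   values on Omega matter. *)
Definition eq_on (R : realType) (s : nat) (Omega : set 'rV[R]_s)
    (g h : 'rV[R]_s -> R) : Prop :=
  forall y, Omega y -> g y = h y.

Definition poly_on (R : realType) (s : nat) (Omega : set 'rV[R]_s) (L : nat) :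
    set ('rV[R]_s -> R) :=
  [set g | exists q : mpoly.mpoly s R,
     all (fun m => (mpoly.mdeg m <= L)%N) (mpoly.msupp q) /\
     eq_on Omega g (fun y => mpoly.meval (fun i => y ord0 i) q)].

Definition lincomb (R : realType) (s d : nat) (p : 'I_d -> 'rV[R]_s -> R)
    (beta : 'I_d -> R) (y : 'rV[R]_s) : R :=
  \sum_(l < d) beta l * p l y.

Definition inner (R : realType) (s : nat) (Omega : set 'rV[R]_s)
    (omega : {measure set (borel_space R s) -> \bar R})
    (v z : 'rV[R]_s -> R) : R :=
  \int[omega]_(y in Omega) (v y * z y).

(* A basis is a family on which every element of the space has exactly one
   vector of coordinates; in particular d is the dimension of P_L. *)
Definition orthonormal_basis (R : realType) (s : nat) (Omega : set 'rV[R]_s)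
    (omega : {measure set (borel_space R s) -> \bar R}) (L d : nat)
    (p : 'I_d -> 'rV[R]_s -> R) : Prop :=
  [/\ forall l, poly_on Omega L (p l),
      forall g, poly_on Omega L g ->
        exists! beta : 'I_d -> R, eq_on Omega g (lincomb p beta) &
      forall i j, inner Omega omega (p i) (p j) = (i == j)%:R].

Definition discrete_inner (R : realType) (s N : nat) (w : 'I_N -> R)
    (x : 'I_N -> 'rV[R]_s) (v z : 'rV[R]_s -> R) : R :=
  \sum_(j < N) w j * v (x j) * z (x j).

Definition soft_threshold (R : realType) (k a : R) : R :=
  Num.max 0 (a - k) + Num.min 0 (a + k).

Definition lasso_hyperinterpolation (R : realType) (s N d : nat)
    (w : 'I_N -> R) (x : 'I_N -> 'rV[R]_s) (p : 'I_d -> 'rV[R]_s -> R)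
    (lambda : R) (mu : 'I_d -> R) (f : 'rV[R]_s -> R) : 'rV[R]_s -> R :=
  lincomb p
    (fun l => soft_threshold (lambda * mu l) (discrete_inner w x f (p l))).

Definition lasso_objective (R : realType) (s N d : nat)
    (w : 'I_N -> R) (x : 'I_N -> 'rV[R]_s) (lambda : R) (mu : 'I_d -> R)
    (f q : 'rV[R]_s -> R) (beta : 'I_d -> R) : R :=
  2^-1 * (\sum_(j < N) w j * (q (x j) - f (x j)) ^+ 2)
  + lambda * \sum_(l < d) `|mu l * beta l|.

(* q is a minimiser over P_L of the objective, in which beta is the coordinate
   vector of the polynomial. *)
Definition lasso_solution (R : realType) (s N d : nat) (Omega : set 'rV[R]_s)
    (L : nat) (w : 'I_N -> R) (x : 'I_N -> 'rV[R]_s)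
    (p : 'I_d -> 'rV[R]_s -> R) (lambda : R) (mu : 'I_d -> R)
    (f q : 'rV[R]_s -> R) : Prop :=
  poly_on Omega L q /\
  exists beta : 'I_d -> R, eq_on Omega q (lincomb p beta) /\
    forall (r : 'rV[R]_s -> R) (gamma : 'I_d -> R),
      poly_on Omega L r -> eq_on Omega r (lincomb p gamma) ->
      lasso_objective w x lambda mu f q beta
        <= lasso_objective w x lambda mu f r gamma.

(* Main.v *)
Require Import Defs.
From HB Require Import structures.
From mathcomp Require Import all_boot all_order all_algebra.
From mathcomp Require Import all_classical all_reals all_analysis.
From mathcomp Require Import lra ring.
From mathcomp Require multinomials.mpoly.
Import (canonicals) mpoly.
Import Order.TTheory GRing.Theory Num.Theory.
Import numFieldNormedType.Exports.
Local Open Scope classical_set_scope.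
Local Open Scope ring_scope.

Set Implicit Arguments.
Unset Strict Implicit.
(** Exactness of degree [2L] turns the discrete inner product of two basis
    polynomials, whose product lies in P_{2L}, into their continuous one, so the
    basis is orthonormal for the discrete inner product as well
    ([discrete_orthonormal]). Expanding the square, the least squares term of
    [sum_l beta_l p_l] then becomes, up to a constant, half the squared
    Euclidean distance between [beta] and the vector [alpha] of the coefficients
    [<f, p_l>_N], and the Lasso problem separates into the scalar problems
    [min_b (b - alpha_l)^2 / 2 + lambda mu_l |b|] ([lasso_objective_separable]).

    Each scalar problem is solved by soft thresholding. As its objective is
    strongly convex, a competitor [b] exceeds the minimum by at least
    [(b - S)^2 / 2], where [S] is the thresholded value ([soft_threshold_gap]).
    Summing over [l], this one inequality gives both that the Lasso
    hyperinterpolant is a minimiser and that any minimiser has the same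
    coordinates ([lasso_objective_gap]). *)

(** * Polynomials on a subset of R^s *)

Lemma poly_on_mul (R : realType) (s : nat) (Omega : set 'rV[R]_s) (L M : nat)
    (g h : 'rV[R]_s -> R) :
  poly_on Omega L g -> poly_on Omega M h ->
  poly_on Omega (L + M) (fun y => g y * h y).
Proof.
move=> [q [/seq.allP qL gq]] [r [/seq.allP rM hr]]; exists (q * r); split.
  apply/seq.allP => m /mpoly.msuppM_le /allpairsP[[m1 m2] /= [m1q m2r ->]].
  by rewrite mpoly.mdegD leq_add ?qL ?rM.
by move=> y Oy; rewrite mpoly.mevalM gq // hr.
Qed.

Lemma poly_on_lincomb (R : realType) (s : nat) (Omega : set 'rV[R]_s)
    (L d : nat) (p : 'I_d -> 'rV[R]_s -> R) (beta : 'I_d -> R) :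
  (forall l, poly_on Omega L (p l)) -> poly_on Omega L (lincomb p beta).
Proof.
move=> pL; rewrite /lincomb; elim: (index_enum _) => [|l r [q [/seq.allP qL rq]]].
  exists 0; split; first by rewrite mpoly.msupp0.
  by move=> y _; rewrite big_nil mpoly.meval0.
have [u [/seq.allP uL pu]] := pL l.
exists (beta l *: u + q); split.
  apply/seq.allP => m /mpoly.msuppD_le; rewrite mem_cat => /orP[|/qL //].
  by move=> /mpoly.msuppZ_le /uL.
by move=> y Oy; rewrite big_cons mpoly.mevalD mpoly.mevalZ pu // rq.
Qed.

(** * The discrete inner product *)

Lemma discrete_innerC (R : realType) (s N : nat) (w : 'I_N -> R)
    (x : 'I_N -> 'rV[R]_s) (v z : 'rV[R]_s -> R) :
  discrete_inner w x v z = discrete_inner w x z v.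
Proof. by apply: eq_bigr => j _; rewrite mulrAC. Qed.

Lemma discrete_inner_lincombr (R : realType) (s N d : nat) (w : 'I_N -> R)
    (x : 'I_N -> 'rV[R]_s) (v : 'rV[R]_s -> R) (p : 'I_d -> 'rV[R]_s -> R)
    (beta : 'I_d -> R) :
  discrete_inner w x v (lincomb p beta)
  = \sum_(l < d) beta l * discrete_inner w x v (p l).
Proof.
rewrite /discrete_inner /lincomb.
under eq_bigr do rewrite mulr_sumr.
rewrite exchange_big; apply: eq_bigr => l _; rewrite mulr_sumr.
by apply: eq_bigr => j _; rewrite mulrCA.
Qed.

(** Products of basis polynomials have degree at most [2L], which is exactly the
    range in which the quadrature rule integrates without error. *)
Lemma discrete_orthonormal (R : realType) (s : nat) (Omega : set 'rV[R]_s)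
    (omega : {measure set (borel_space R s) -> \bar R})
    (L d : nat) (p : 'I_d -> 'rV[R]_s -> R)
    (N : nat) (x : 'I_N -> 'rV[R]_s) (w : 'I_N -> R) :
  orthonormal_basis Omega omega L p ->
  (forall g : 'rV[R]_s -> R, poly_on Omega (2 * L) g ->
     \sum_(j < N) w j * g (x j) = \int[omega]_(y in Omega) g y) ->
  forall i j, discrete_inner w x (p i) (p j) = (i == j)%:R.
Proof.
move=> [pL _ p_on] exact2L i j; rewrite -p_on /inner -exact2L.
  by apply: eq_bigr => k _; rewrite mulrA.
by rewrite mul2n -addnn; apply: poly_on_mul.
Qed.

(** * Soft thresholding *)

(** This is the variational inequality [(b - S) (S - a) + k |b| - k |S| >= 0]
    expressing that [a - S] is a subgradient of [k |.|] at [S], with the square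
    of [b - a = (b - S) + (S - a)] completed. *)
Lemma soft_threshold_gap (R : realType) (k a b : R) : 0 <= k ->
  2^-1 * (soft_threshold k a - a) ^+ 2 + k * `|soft_threshold k a|
  + 2^-1 * (b - soft_threshold k a) ^+ 2
  <= 2^-1 * (b - a) ^+ 2 + k * `|b|.
Proof.
move=> k0; set S := soft_threshold k a.
suff vi : 0 <= (b - S) * (S - a) + k * `|b| - k * `|S|.
  rewrite -subr_ge0; apply: le_trans vi _; rewrite le_eqVlt; apply/orP; left.
  by apply/eqP; field.
have [leb leNb] : k * b <= k * `|b| /\ - (k * b) <= k * `|b|.
  by rewrite -mulrN !ler_wpM2l // ?ler_norm // ler_normr lexx orbT.
rewrite /S /soft_threshold => {S}.
(* The cases [a > k], [a < - k] and [|a| <= k], in which [S] is [a - k],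
   [a + k] and [0]. *)
have [ka|ak] := ltP k a.
  rewrite max_r ?min_l ?addr0; try lra.
  rewrite (@ger0_norm _ (a - k)); last lra.
  nra.
have [aNk|Nka] := ltP a (- k).
  rewrite max_l ?min_r ?add0r; try lra.
  rewrite (@ler0_norm _ (a + k)); last lra.
  nra.
rewrite max_l ?min_l ?addr0; try lra.
rewrite normr0 mulr0 subr0 sub0r subr0 mulrN addrC subr_ge0.
apply: le_trans (ler_norm _) _; rewrite normrM mulrC ler_wpM2r //.
by rewrite ler_norml Nka ak.
Qed.

(** * The Lasso objective in coordinates *)

Lemma eq_on_lasso_objective (R : realType) (s N d : nat)
    (Omega : set 'rV[R]_s) (w : 'I_N -> R) (x : 'I_N -> 'rV[R]_s)
    (lambda : R) (mu : 'I_d -> R) (f q r : 'rV[R]_s -> R) (beta : 'I_d -> R) :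
  (forall j, Omega (x j)) -> eq_on Omega q r ->
  lasso_objective w x lambda mu f q beta
  = lasso_objective w x lambda mu f r beta.
Proof.
move=> xO qr; rewrite /lasso_objective; congr (_ * _ + _).
by apply: eq_bigr => j _; rewrite qr.
Qed.

(** The last term, half the squared discrete distance from [f] to the span of
    the [p l], does not depend on [beta]. *)
Lemma lasso_objective_separable (R : realType) (s N d : nat)
    (w : 'I_N -> R) (x : 'I_N -> 'rV[R]_s) (p : 'I_d -> 'rV[R]_s -> R)
    (lambda : R) (mu : 'I_d -> R) (f : 'rV[R]_s -> R) (beta : 'I_d -> R) :
  (forall i j, discrete_inner w x (p i) (p j) = (i == j)%:R) ->
  (forall l, 0 <= mu l) ->
  lasso_objective w x lambda mu f (lincomb p beta) beta
  = \sum_(l < d) (2^-1 * (beta l - discrete_inner w x f (p l)) ^+ 2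
                  + lambda * mu l * `|beta l|)
    + 2^-1 * (discrete_inner w x f f
              - \sum_(l < d) discrete_inner w x f (p l) ^+ 2).
Proof.
move=> p_on mu0; rewrite /lasso_objective.
set P := lincomb p beta; set a := fun l => discrete_inner w x f (p l).
have PP : discrete_inner w x P P = \sum_(l < d) beta l ^+ 2.
  rewrite discrete_inner_lincombr; apply: eq_bigr => l _.
  rewrite discrete_innerC discrete_inner_lincombr (bigD1 l) //= big1 => [|i il].
    by rewrite p_on eqxx mulr1 addr0.
  by rewrite p_on eq_sym (negbTE il) mulr0.
have fP : discrete_inner w x f P = \sum_(l < d) beta l * a l.
  exact: discrete_inner_lincombr.
have -> : \sum_(j < N) w j * (P (x j) - f (x j)) ^+ 2
    = discrete_inner w x P P - 2 * discrete_inner w x f P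
      + discrete_inner w x f f.
  rewrite /discrete_inner mulr_sumr -sumrB -big_split /=.
  by apply: eq_bigr => j _; ring.
have -> : lambda * (\sum_(l < d) `|mu l * beta l|)
    = \sum_(l < d) lambda * mu l * `|beta l|.
  rewrite mulr_sumr; apply: eq_bigr => l _.
  by rewrite normrM ger0_norm // mulrA.
have -> : \sum_(l < d) (2^-1 * (beta l - a l) ^+ 2 + lambda * mu l * `|beta l|)
    = 2^-1 * (\sum_(l < d) beta l ^+ 2 - 2 * (\sum_(l < d) beta l * a l)
              + \sum_(l < d) a l ^+ 2)
      + \sum_(l < d) lambda * mu l * `|beta l|.
  rewrite [2 * _]mulr_sumr -sumrB -big_split mulr_sumr -big_split /=.
  by apply: eq_bigr => l _; ring.
by rewrite PP fP; ring.
Qed.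

(** Strong convexity of the Lasso objective at the thresholded coefficients:
    both optimality and uniqueness are read off from the quadratic term. *)
Lemma lasso_objective_gap (R : realType) (s N d : nat)
    (w : 'I_N -> R) (x : 'I_N -> 'rV[R]_s) (p : 'I_d -> 'rV[R]_s -> R)
    (lambda : R) (mu : 'I_d -> R) (f : 'rV[R]_s -> R) (beta : 'I_d -> R) :
  (forall i j, discrete_inner w x (p i) (p j) = (i == j)%:R) ->
  0 <= lambda -> (forall l, 0 <= mu l) ->
  let sigma l := soft_threshold (lambda * mu l) (discrete_inner w x f (p l)) in
  lasso_objective w x lambda mu f (lincomb p sigma) sigma
  + 2^-1 * (\sum_(l < d) (beta l - sigma l) ^+ 2)
  <= lasso_objective w x lambda mu f (lincomb p beta) beta.
Proof.
move=> p_on lambda0 mu0; cbv zeta; set sigma := fun l => soft_threshold _ _.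
rewrite !lasso_objective_separable // addrAC lerD2r mulr_sumr -big_split /=.
by apply: ler_sum => l _; apply: soft_threshold_gap; rewrite mulr_ge0.
Qed.

Unset Implicit Arguments.
Set Strict Implicit.

Theorem theorem3p4 (R : realType) (s : nat) (Omega : set 'rV[R]_s)
    (hOmega : compact_smooth_manifold Omega)
    (omega : {measure set (borel_space R s) -> \bar R})
    (homega : (omega Omega < +oo)%E)
    (L d : nat) (p : 'I_d -> 'rV[R]_s -> R)
    (hp : orthonormal_basis Omega omega L p)
    (f : 'rV[R]_s -> R)
    (hf : {within Omega, continuous f})
    (hf0 : exists2 y, Omega y & f y != 0)
    (lambda : R) (hlambda : 0 < lambda)
    (mu : 'I_d -> R) (hmu : forall l, 0 < mu l)
    (N : nat) (x : 'I_N -> 'rV[R]_s)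
    (hxOmega : forall j, Omega (x j)) (hxinj : injective x)
    (w : 'I_N -> R) (hw : forall j, 0 < w j)
    (hexact : forall g : 'rV[R]_s -> R, poly_on Omega (2 * L) g ->
       \sum_(j < N) w j * g (x j) = \int[omega]_(y in Omega) g y) :
  lasso_solution Omega L w x p lambda mu f
    (lasso_hyperinterpolation w x p lambda mu f)
  /\ forall q : 'rV[R]_s -> R,
       lasso_solution Omega L w x p lambda mu f q ->
       eq_on Omega q (lasso_hyperinterpolation w x p lambda mu f).
Proof.
have p_on := discrete_orthonormal hp hexact.
have [pL _ _] := hp.
pose sigma l := soft_threshold (lambda * mu l) (discrete_inner w x f (p l)).
pose obj beta := lasso_objective w x lambda mu f (lincomb p beta) beta.
have gap beta :
    obj sigma + 2^-1 * (\sum_(l < d) (beta l - sigma l) ^+ 2) <= obj beta.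
  by apply: lasso_objective_gap => // [|l]; apply: ltW.
have lassoL : poly_on Omega L (lasso_hyperinterpolation w x p lambda mu f).
  exact: poly_on_lincomb.
split.
  split=> //; exists sigma; split=> // r gamma _ /eq_on_lasso_objective -> //.
  apply: le_trans (gap gamma); rewrite lerDl mulr_ge0 ?invr_ge0 //.
  by apply: sumr_ge0 => l _; rewrite sqr_ge0.
move=> q [_ [beta [qb qmin]]] y Oy; rewrite qb //.
have le_obj : obj beta <= obj sigma.
  have := qmin _ sigma lassoL (fun _ _ => erefl).
  by rewrite (eq_on_lasso_objective _ _ _ _ _ hxOmega qb).
have sq_ge0 l : true -> 0 <= (beta l - sigma l) ^+ 2 by rewrite sqr_ge0.
have /eqP : \sum_(l < d) (beta l - sigma l) ^+ 2 = 0.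
  apply/eqP; rewrite eq_le sumr_ge0 // andbT.
  by have := le_trans (gap beta) le_obj; rewrite gerDl pmulr_rle0 ?invr_gt0.
rewrite psumr_eq0 // => /seq.allP sq0; apply: eq_bigr => l _; congr (_ * _).
by apply/eqP; rewrite -subr_eq0 -sqrf_eq0; apply: sq0; rewrite mem_index_enum.
Qed.
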